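(* Let $\rho > 0$, let $D\subseteq\mathbb{F}_q$, let $d=\rho|D|$ and let $V=\mathsf{RS}[\mathbb{F}_q,D,\rho]$. For $z,b \in \mathbb{F}_q$ let $V_{z,b} = \{ Q(Y)|_D \in V \mid Q(z) = b \}$ (where $Q$ ranges over polynomials of degree $<d$). For $\delta>0$ let $L^*_{\delta} = \mathcal{L}(\mathbb{F}_q, D, d, \delta)$. Let $u,u^* \in \mathbb{F}_q^D$ and for each $z\in \mathbb{F}_q$ let $B_z(X) \in \mathbb{F}_q[X]$ be an arbitrary linear (degree $\le 1$) polynomial. Suppose that for some $0<\epsilon<1/3$, $$\Pr_{x, z \in \mathbb{F}_q} [ \Delta( u^* + x u, V_{z, B_z(x)}) < \delta ] \geq \max\left(2L^*_{\delta} \left( \frac{d}{q} + \epsilon\right)^{1/3} , \frac{4}{\epsilon^2 q} \right),$$ with $x,z$ independent and uniform in $\mathbb{F}_q$. Then there exist $v, v^*\in V$ and $C \subseteq D$ such that $|C| \geq (1-\delta-\epsilon) |D|$, $u|_{C}=v|_{C}$ and $u^*|_{C}=v^*|_{C}$. Consequently $\Delta(u, V), \Delta(u^*, V) \leq \delta + \epsilon$.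
   Context: $\mathbb{F}_q^D$ is the set of functions $D\to\mathbb{F}_q$. $\Delta(u,v)=\Pr_{y\in D}[u(y)\neq v(y)]$ is relative Hamming distance and $\Delta(u,S)=\min_{s\in S}\Delta(u,s)$. $\mathsf{RS}[\mathbb{F}_q,D,\rho]$ is the set of $f:D\to\mathbb{F}_q$ whose interpolating polynomial has degree $<\rho|D|$ (codewords are identified with these polynomials). For $u\in\mathbb{F}_q^D$, $V\subseteq\mathbb{F}_q^D$ and $\delta\in[0,1]$, $\mathrm{List}(u,V,\delta)=\{v\in V:\Delta(u,v)<\delta\}$. $\mathcal{L}(\mathbb{F}_q,D,d,\delta)$ is the maximum of $|\mathrm{List}(u,V,\delta)|$ over all $u\in\mathbb{F}_q^D$, for $V=\mathsf{RS}[\mathbb{F}_q,D,d/|D|]$. *)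

(* Defs.v *)
From HB Require Import structures.
From mathcomp Require Import all_boot all_order all_algebra.
From mathcomp Require Import boolp reals exp.

Set Implicit Arguments.
Unset Strict Implicit.
Unset Printing Implicit Defensive.

Import Order.TTheory GRing.Theory Num.Theory.
Local Open Scope ring_scope.

(* Probability of [P] under the uniform distribution on [T]. *)
Definition uprob (R : realType) (T : finType) (P : pred T) : R :=
  #|[set t | P t]|%:R / #|T|%:R.

(* The space F_q^D of functions from the subset D of F_q to F_q. *)
Definition word (F : finFieldType) (D : {set F}) : finType :=
  {ffun {y : F | y \in D} -> F}.

Definition rdist (R : realType) (F : finFieldType) (D : {set F})
    (u v : word D) : R :=
  uprob R [pred y | u y != v y].

(* Relative distances are at most 1, so this is the minimum of [rdist R u] over
   [S] whenever [S] is nonempty (and 1 when [S] is empty). *)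
Definition rdist_set (R : realType) (F : finFieldType) (D : {set F})
    (u : word D) (S : {set word D}) : R :=
  \big[Order.min/1]_(s in S) rdist R u s.

(* deg Q < d for a real bound d; the zero polynomial has degree -oo. *)
Definition deg_lt (R : realType) (F : finFieldType) (Q : {poly F}) (d : R) :
    bool :=
  (Q == 0) || ((size Q).-1%:R < d).

Definition restr (F : finFieldType) (D : {set F}) (Q : {poly F}) : word D :=
  [ffun y => Q.[val y]].

(* [Q] is the interpolating polynomial of [f], that is, the unique polynomial of
   degree less than |D| that agrees with [f] on [D]. *)
Definition interpolates (F : finFieldType) (D : {set F}) (Q : {poly F})
    (f : word D) : Prop :=
  (size Q <= #|D|)%N /\ restr D Q = f.

Definition RS (R : realType) (F : finFieldType) (D : {set F}) (rho : R) :
    {set word D} :=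
  [set f | `[< exists Q : {poly F},
                 interpolates Q f /\ deg_lt Q (rho * #|D|%:R) >]].

(* The set V_{z,b} of restrictions Q|_D in V = RS[F_q, D, rho] with
   deg Q < rho |D| and Q(z) = b. *)
Definition RSpt (R : realType) (F : finFieldType) (D : {set F}) (rho : R)
    (z b : F) : {set word D} :=
  [set f in RS D rho | `[< exists Q : {poly F},
      [/\ deg_lt Q (rho * #|D|%:R), restr D Q = f & Q.[z] = b] >]].

Definition List (R : realType) (F : finFieldType) (D : {set F})
    (u : word D) (V : {set word D}) (delta : R) : {set word D} :=
  [set v in V | rdist R u v < delta].

Definition max_list_size (R : realType) (F : finFieldType) (D : {set F})
    (d delta : R) : nat :=
  \max_(u : word D) #|List u (RS D (d / #|D|%:R)) delta|.

(* The word u* + x u. *)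
Definition affine_word (F : finFieldType) (D : {set F}) (ustar u : word D)
    (x : F) : word D :=
  [ffun y => ustar y + x * u y].

(* Main.v *)
Require Import Defs.
From HB Require Import structures.
From mathcomp Require Import all_boot all_order all_algebra.
From mathcomp Require Import boolp reals exp.
From mathcomp Require Import ring lra.

Set Implicit Arguments.
Unset Strict Implicit.
Unset Printing Implicit Defensive.

Import Order.TTheory GRing.Theory Num.Theory.
Local Open Scope ring_scope.

(* For each x fix the codeword v_x close to us + x u that agrees with B_z(x) at
   the largest number of points z; if the list has at most L elements, this
   loses only a factor L. By convexity of the cube, for many triples (x, y, w)
   there are at least d points z at which v_x, v_y, v_w take the values of the
   line B_z at x, y, w, and then the polynomials v_x, v_y, v_w themselves lie on
   a line. Some pair x <> y works for many w, so us + w u is delta-close to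
   vs + w v for more than 1/eps parameters w; two distinct lines over a point of
   D meet for at most one w, hence (u, us) and (v, vs) agree on all but a
   delta + eps fraction of D. *)

(** * Convexity of the cube and counting of triples *)

Lemma card_set_sum (R : realType) (T : finType) (P : pred T) :
  #|[set x | P x]|%:R = \sum_x (P x)%:R :> R.
Proof.
rewrite -sum1_card natr_sum [RHS](bigID P) /= [X in _ = _ + X]big1 ?addr0.
  by apply: eq_big => [x|x]; rewrite inE // => ->.
by move=> x /negPf->.
Qed.

Lemma sum_const (R : realType) (T : finType) (c : R) :
  \sum_(x : T) c = #|T|%:R * c.
Proof. by rewrite mulr_natl sumr_const. Qed.

Lemma sum_cube (R : realType) (T : finType) (f : T -> R) :
  (\sum_x f x) ^+ 3 = \sum_x \sum_y \sum_z f x * f y * f z.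
Proof.
rewrite exprS expr2 mulr_suml; apply: eq_bigr => x _.
rewrite mulr_suml mulr_sumr; apply: eq_bigr => y _.
by rewrite mulrA mulr_sumr.
Qed.

Lemma power_mean3 (R : realType) (T : finType) (n : T -> R) (m : R) :
  0 <= m -> (forall z, 0 <= n z) -> #|T|%:R * m <= \sum_z n z ->
  #|T|%:R * m ^+ 3 <= \sum_z n z ^+ 3.
Proof.
move=> m0 n0 H.
(* n^3 lies above its tangent at m. *)
have tangent z : 3 * m ^+ 2 * n z - 2 * m ^+ 3 <= n z ^+ 3.
  rewrite -subr_ge0.
  have -> : n z ^+ 3 - (3 * m ^+ 2 * n z - 2 * m ^+ 3) =
    (n z - m) ^+ 2 * (n z + 2 * m) by ring.
  by rewrite mulr_ge0 ?sqr_ge0 // addr_ge0 // mulr_ge0.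
apply: le_trans (ler_sum _ (fun z _ => tangent z)).
rewrite big_split /= -mulr_sumr sum_const.
have : 3 * m ^+ 2 * (#|T|%:R * m) <= 3 * m ^+ 2 * \sum_z n z.
  by apply: ler_wpM2l => //; rewrite mulr_ge0 ?sqr_ge0.
set S := \sum_z _; set q := #|T|%:R; move=> K; lra.
Qed.

(** Later [g x z] says that the codeword chosen for x is close to the word at x and meets the line
    [B z] at the point z. *)
Definition common_pts (T Z : finType) (g : T -> Z -> bool) (x y w : T) :
    {set Z} :=
  [set z | [&& g x z, g y z & g w z]].

(** Double counting: a point z lies in the common set of exactly the ordered triples drawn from its
    own set of parameters. *)
Lemma sum_common_pts (R : realType) (T Z : finType) (g : T -> Z -> bool) :
  \sum_x \sum_y \sum_w #|common_pts g x y w|%:R =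
  \sum_z (\sum_x (g x z)%:R) ^+ 3 :> R.
Proof.
under [RHS]eq_bigr do rewrite sum_cube.
rewrite [RHS]exchange_big; apply: eq_bigr => x _ /=.
rewrite [RHS]exchange_big; apply: eq_bigr => y _ /=.
rewrite [RHS]exchange_big; apply: eq_bigr => w _ /=.
rewrite card_set_sum; apply: eq_bigr => z _.
by rewrite -!natrM !mulnb andbA.
Qed.

(** Convexity gives a total of at least 8 q^3 d + 8 eps q^4 common points. Triples with fewer than d
    points account for at most q^3 d, and the others for at most q each, so at least 8 eps q^3
    triples are rich. The diagonal x = y holds at most q^2 of these, which costs the -1. *)
Lemma rich_pair (R : realType) (T : finType) (g : T -> T -> bool)
    (d eps t : R) :
  let q : R := #|T|%:R in
  0 <= d -> 0 <= t -> t ^+ 3 = d / q + eps -> 1 < 8 * eps * q ->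
  2 * t * q ^+ 2 <= \sum_z \sum_x (g x z)%:R ->
  exists x y, x != y /\
    8 * eps * q - 1 <= #|[set w | d <= #|common_pts g x y w|%:R]|%:R.
Proof.
move=> q d0 t0 t3 hq hM.
have q0 : 0 < q.
  rewrite lt_def ler0n andbT; apply: contraTneq hq => ->.
  by rewrite mulr0 -leNgt ler01.
pose rich x y : R := #|[set w | d <= #|common_pts g x y w|%:R]|%:R.
apply: contrapT => H.
(* The term q on the diagonal cancels the -1 summed over a row, so a row of these bounds adds up to
   exactly q (8 eps q). *)
have small x y : rich x y < 8 * eps * q - 1 + q * (x == y)%:R.
  have [->|xy] := eqVneq x y.
    apply: (@le_lt_trans _ _ q); first by rewrite /rich ler_nat max_card.
    by rewrite mulr1; lra.
  rewrite mulr0 addr0 ltNge; apply/negP => h; apply: H.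
  by exists x, y.
have q4 : 8 * q ^+ 4 * (d / q + eps) <= \sum_z (\sum_x (g x z)%:R) ^+ 3.
  have -> : 8 * q ^+ 4 * (d / q + eps) = q * (2 * t * q) ^+ 3.
    by rewrite -t3; ring.
  apply: power_mean3.
  - by rewrite !mulr_ge0 // ltW.
  - by move=> z; apply: sumr_ge0.
  - by apply: le_trans hM; rewrite -/q; lra.
have upper : \sum_z (\sum_x (g x z)%:R) ^+ 3 <=
    q * (\sum_x \sum_y rich x y) + q ^+ 3 * d.
  rewrite -sum_common_pts.
  apply: (@le_trans _ _ (\sum_x \sum_y (q * rich x y + q * d))).
    apply: ler_sum => x _; apply: ler_sum => y _.
    rewrite /rich card_set_sum mulr_sumr -[q * d]sum_const -big_split /=.
    apply: ler_sum => w _; case: (boolP (d <= _)) => [_|] /=.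
      by rewrite mulr1 ler_wpDr // ler_nat max_card.
    by rewrite -ltNge mulr0 add0r => /ltW.
  have row x : \sum_y (q * rich x y + q * d) =
      q * (\sum_y rich x y) + q * (q * d).
    by rewrite big_split /= sum_const -mulr_sumr.
  under eq_bigr do rewrite row.
  by rewrite big_split /= sum_const -mulr_sumr -/q !exprS expr0; lra.
have lower : \sum_x \sum_y rich x y < q ^+ 2 * (8 * eps * q).
  have -> : q ^+ 2 * (8 * eps * q) =
      \sum_x \sum_y (8 * eps * q - 1 + q * (x == y :> T)%:R).
    have row x : \sum_y (8 * eps * q - 1 + q * (x == y :> T)%:R) =
        q * (8 * eps * q).
      rewrite big_split /= sum_const -mulr_sumr (bigD1 x) //= eqxx big1.
        by rewrite addr0 mulr1 -/q; ring.
      by move=> y; rewrite eq_sym => /negPf->.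
    by under eq_bigr do rewrite row; rewrite sum_const -/q; ring.
  have [x0 _] : exists x : T, x \in T.
    by apply/card_gt0P; rewrite -(ltr_nat R).
  apply: ltr_sum; first by apply/hasP; exists x0; rewrite // mem_index_enum.
  move=> x _; apply: ltr_sum => //.
  by apply/hasP; exists x0; rewrite // mem_index_enum.
have : 8 * q ^+ 4 * (d / q + eps) =
    8 * q ^+ 3 * d + q * (q ^+ 2 * (8 * eps * q)).
  by field; rewrite gt_eqF.
have : q * (\sum_x \sum_y rich x y) < q * (q ^+ 2 * (8 * eps * q)).
  by rewrite ltr_pM2l.
have : 0 <= q ^+ 3 * d by rewrite mulr_ge0 // exprn_ge0 // ltW.
move: q4 upper; set a := q * (q ^+ 2 * _); set b := q * _; lra.
Qed.

(** * Polynomials under a real degree bound *)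

(** In coefficientwise form, closure under linear combinations needs no case distinction on zero
    polynomials or cancelling leading terms. *)
Lemma deg_lt_coefP (R : realType) (F : finFieldType) (Q : {poly F}) (d : R) :
  deg_lt Q d <-> forall i, Q`_i != 0 -> i%:R < d.
Proof.
rewrite /deg_lt; split=> [|H].
  case/orP=> [/eqP->|Qd] i; first by rewrite coef0 eqxx.
  have [iQ|/(nth_default 0)->] := ltnP i (size Q); last by rewrite eqxx.
  by move=> _; apply: le_lt_trans Qd; rewrite ler_nat; case: size iQ.
by have [//|Q0] := eqVneq Q 0; apply: H; rewrite -/(lead_coef Q) lead_coef_eq0.
Qed.

Lemma deg_lt_comb (R : realType) (F : finFieldType) (P Q : {poly F}) (a b : F)
    (d : R) :
  deg_lt P d -> deg_lt Q d -> deg_lt (a *: P + b *: Q) d.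
Proof.
move=> /deg_lt_coefP hP /deg_lt_coefP hQ; apply/deg_lt_coefP => i.
have [Pi|Pi _] := eqVneq P`_i 0; last exact: hP.
have [Qi|Qi _] := eqVneq Q`_i 0; last exact: hQ.
by rewrite coefD !coefZ Pi Qi !mulr0 addr0 eqxx.
Qed.

Lemma deg_lt_roots (R : realType) (F : finFieldType) (P : {poly F}) (d : R)
    (A : {set F}) :
  deg_lt P d -> {in A, forall z, P.[z] = 0} -> d <= #|A|%:R -> P = 0.
Proof.
move=> Pd PA dA; apply/eqP; case/orP: Pd => // Pd.
have [//|P0] := eqVneq P 0.
have := max_poly_roots P0 (rs := enum A).
rewrite enum_uniq -cardE => /(_ _ isT) lt_A.
have {lt_A} : (#|A| < size P)%N.
  by apply: lt_A; apply/allP => z; rewrite mem_enum => /PA; rewrite rootE => ->.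
have := lt_le_trans Pd dA; rewrite ltr_nat.
by case: (size P) => // n /=; rewrite ltnS => /leq_trans h /h; rewrite ltnn.
Qed.

Lemma deg_lt_size (R : realType) (F : finFieldType) (P : {poly F}) (d : R)
    (n : nat) :
  deg_lt P d -> d <= n%:R -> (size P <= n)%N.
Proof.
case/orP=> [/eqP-> _|Pd dn]; first by rewrite size_poly0.
by have := lt_le_trans Pd dn; rewrite ltr_nat; case: size.
Qed.

(** * Interpolation, Reed-Solomon codes and distance *)

Lemma card_dom (F : finFieldType) (D : {set F}) :
  #|{: {y : F | y \in D}}| = #|D|.
Proof. by rewrite card_sig. Qed.

Lemma interpolates_exists (F : finFieldType) (D : {set F}) (f : word D) :
  exists Q, interpolates Q f.
Proof.
(* The Lagrange numerator at y: it vanishes on D except at y. *)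
pose w (y : F) : {poly F} := \prod_(x <- enum (D :\ y)) ('X - x%:P).
have wE y x : ((w y).[x] == 0) = (x \in D :\ y).
  by rewrite -[_ == 0]/(root _ _) root_prod_XsubC mem_enum.
exists (\sum_(y : {y | y \in D}) (f y / (w (val y)).[val y]) *: w (val y)).
split.
  apply: (leq_trans (size_sum _ _ _)); apply/bigmax_leqP => y _.
  apply: (leq_trans (size_scale_leq _ _)).
  rewrite /w size_prod_XsubC -cardE.
  by rewrite [X in (_ <= X)%N](cardsD1 (val y)) (valP y).
apply/ffunP => y; rewrite ffunE horner_sum (bigD1 y) //= big1 => [|x xy].
  by rewrite addr0 hornerZ divfK // wE !inE eqxx.
rewrite hornerZ; have /eqP-> : (w (val x)).[val y] == 0.
  by rewrite wE !inE (valP y) andbT; rewrite eq_sym in xy.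
by rewrite mulr0.
Qed.

(** For [rho <= 1] the degree bound is at most |D|, so [Q] is itself the interpolating
    polynomial. *)
Lemma RS_restr (R : realType) (F : finFieldType) (D : {set F}) (rho : R)
    (Q : {poly F}) :
  rho <= 1 -> deg_lt Q (rho * #|D|%:R) -> restr D Q \in RS D rho.
Proof.
move=> rho1 Qd; rewrite inE; apply/asboolP; exists Q; split=> //; split=> //.
by apply: deg_lt_size Qd _; rewrite ler_piMl.
Qed.

Lemma RS_full (R : realType) (F : finFieldType) (D : {set F}) (rho : R)
    (f : word D) :
  1 <= rho -> f \in RS D rho.
Proof.
move=> rho1; have [Q [sQ Qf]] := interpolates_exists f.
rewrite inE; apply/asboolP; exists Q; split=> //.
rewrite /deg_lt; have [//|Q0] := eqVneq Q 0.
apply: (@lt_le_trans _ _ #|D|%:R); last by rewrite ler_peMl.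
by rewrite ltr_nat (leq_trans _ sQ) // prednK // lt0n size_poly_eq0.
Qed.

Lemma rdist_le (R : realType) (F : finFieldType) (D : {set F}) (u v : word D)
    (c : R) :
  0 <= c ->
  (rdist R u v <= c) = (\sum_y (u y != v y)%:R <= c * #|D|%:R).
Proof.
move=> c0; rewrite /rdist /uprob card_dom card_set_sum /=.
have [D0|Dp] := posnP #|D|; last by rewrite ler_pdivrMr // ltr0n.
(* Over an empty domain the distance is a quotient by zero, hence 0, and the sum is empty. *)
rewrite D0 invr0 !mulr0 c0 big1 ?lexx // => y.
have /card_gt0P : exists x, x \in D by exists (val y); exact: valP.
by rewrite D0.
Qed.

Lemma rdist_set_le (R : realType) (F : finFieldType) (D : {set F})
    (u v : word D) (V : {set word D}) (C : {set {y : F | y \in D}}) (c : R) :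
  0 <= c -> v \in V -> (1 - c) * #|D|%:R <= #|C|%:R ->
  (forall y, y \in C -> u y = v y) -> rdist_set R u V <= c.
Proof.
move=> c0 vV hC uv; apply: le_trans (bigmin_le_cond _ _ vV) _.
rewrite rdist_le //.
have : \sum_y (u y != v y)%:R <= #|~: C|%:R :> R.
  rewrite -card_set_sum ler_nat; apply/subset_leq_card/subsetP => y.
  by rewrite !inE; apply: contra => /uv->.
have -> : #|~: C|%:R = #|D|%:R - #|C|%:R :> R.
  by apply/eqP; rewrite eq_sym subr_eq addrC -natrD cardsC card_dom.
move: hC; set A := \sum_y _; lra.
Qed.

(** * Lines of words and lines of codewords *)

(* A point outside the common agreement set lies on both lines for at most one
   parameter, so it is counted as a disagreement for all but one element of S. *)
Lemma line_agreement (R : realType) (F : finFieldType) (D : {set F})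
    (u us v vs : word D) (S : {set F}) (delta : R) :
  let C := [set y | (u y == v y) && (us y == vs y)] in
  0 <= delta ->
  {in S, forall x, rdist R (affine_word us u x) (affine_word vs v x) <= delta} ->
  #|S|%:R * (1 - delta) * #|D|%:R - #|D|%:R <= #|S|%:R * #|C|%:R :> R.
Proof.
move=> C delta0 close.
pose bad x y := affine_word us u x y != affine_word vs v x y.
have upper : \sum_(x in S) \sum_y (bad x y)%:R <= #|S|%:R * (delta * #|D|%:R).
  rewrite mulr_natl -sumr_const; apply: ler_sum => x /close.
  by rewrite rdist_le.
have lower : (#|D|%:R - #|C|%:R) * (#|S|%:R - 1) <=
    \sum_(x in S) \sum_y (bad x y)%:R :> R.
  rewrite exchange_big /= (bigID (mem C)) /= ler_wpDl ?sumr_ge0 //.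
    by move=> y _; apply: sumr_ge0.
  have -> : #|D|%:R - #|C|%:R = #|~: C|%:R :> R.
    by apply/eqP; rewrite subr_eq addrC -natrD cardsC card_dom.
  rewrite mulr_natl -sumr_const.
  rewrite [X in _ <= X](eq_bigl (mem (~: C))) => [|y];
    last by rewrite -[RHS]/(y \in ~: C) in_setC.
  apply: ler_sum => y; rewrite !inE => yC.
  have -> : #|S|%:R = \sum_(x in S) (bad x y)%:R +
      #|[set x in S | ~~ bad x y]|%:R :> R.
    rewrite card_set_sum -sum1_card natr_sum big_mkcond [in RHS]big_mkcond /=.
    rewrite -big_split /=; apply: eq_bigr => x _.
    by case: (x \in S); case: (bad x y); rewrite /= ?addr0 ?add0r.
  rewrite lerBlDr lerD2l.
  (* Agreement at two distinct parameters would force u y = v y, then us y = vs y, putting y in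
     [C]. *)
  rewrite lern1; apply/card_le1_eqP => x x'.
  rewrite !inE => /andP[_ /negPn/eqP]; rewrite !ffunE => ex.
  move=> /andP[_ /negPn/eqP]; rewrite !ffunE => ex'.
  apply/eqP; apply: contraNT yC; rewrite eq_sym => xx'.
  have : (x - x') * (u y - v y) == 0.
    apply/eqP; transitivity ((us y + x * u y) - (us y + x' * u y) -
      ((vs y + x * v y) - (vs y + x' * v y))); first by ring.
    by rewrite ex ex'; ring.
  rewrite mulf_eq0 subr_eq0 (negPf xx') subr_eq0 /= => /eqP uv.
  by rewrite uv eqxx -(can_eq (addrK (x * v y))) -ex uv eqxx.
have : 0 <= #|C|%:R :> R by [].
move: upper lower; set s := #|S|%:R; set X := \sum_(x in S) _; lra.
Qed.

(** Pigeonhole. Membership [v \in L] sits inside the counted set so that an empty [L] is covered: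
    then [A] is empty and any v serves. *)
Lemma popular_element (W Z : finType) (w0 : W) (L : {set W}) (A : {set Z})
    (E : W -> {set Z}) :
  A \subset \bigcup_(v in L) E v ->
  exists v, (#|A| <= #|L| * #|[set z in E v | v \in L]|)%N.
Proof.
move=> AE; pose c v := #|[set z in E v | v \in L]|.
exists [arg max_(v > w0) c v]%N; case: arg_maxnP => // v _ vmax.
apply: (leq_trans (subset_leq_card AE)).
apply: (@leq_trans (\sum_(w in L) #|E w|)).
  elim/big_rec2: _ => [|w n B _ h]; first by rewrite cards0.
  by apply: leq_trans (leq_card_setU _ _) _; rewrite leq_add2l.
rewrite -sum_nat_const; apply: leq_sum => w wL.
apply: leq_trans (vmax w isT); rewrite /c; apply: subset_leq_card.
by apply/subsetP => z zE; rewrite inE zE.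
Qed.

(** A polynomial of degree below d <= |D| is determined by its restriction, so its value at z, even
    outside D, depends only on the codeword. *)
Lemma deg_lt_restr_horner (R : realType) (F : finFieldType) (D : {set F})
    (rho : R) (z b : F) (P Q : {poly F}) :
  let d := rho * #|D|%:R in
  rho <= 1 -> deg_lt P d -> deg_lt Q d -> restr D P = restr D Q ->
  P.[z] = b -> Q.[z] = b.
Proof.
move=> d rho1 Pd Qd PQ <-; congr (_.[z]); apply/eqP; rewrite -subr_eq0.
apply/eqP; apply: (@deg_lt_roots R _ _ d D); last by rewrite /d ler_piMl.
  by have := deg_lt_comb 1 (-1) Qd Pd; rewrite scale1r scaleN1r.
move=> y yD; move/ffunP/(_ (exist _ y yD)): PQ; rewrite !ffunE /= => PQy.
by rewrite hornerD hornerN PQy subrr.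
Qed.

Lemma list_size_le (R : realType) (F : finFieldType) (D : {set F})
    (rho delta : R) (u : word D) :
  (0 < #|D|)%N ->
  (#|List u (RS D rho) delta| <= max_list_size D (rho * #|D|%:R) delta)%N.
Proof.
move=> D0; rewrite /max_list_size mulfK ?pnatr_eq0 -?lt0n //.
exact: (leq_bigmax_cond (F := fun w => #|List w (RS D rho) delta|)).
Qed.

Lemma uprob_prod (R : realType) (F : finFieldType) (P : F -> F -> bool) :
  uprob R [pred xz : F * F | P xz.1 xz.2] * #|F|%:R ^+ 2 =
  (\sum_x #|[set z | P x z]|)%:R.
Proof.
have q0 : #|F|%:R != 0 :> R 
  by rewrite pnatr_eq0 -lt0n; apply/card_gt0P; exists 0.
rewrite /uprob card_prod natrM -expr2 divfK ?expf_neq0 //.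
rewrite card_set_sum natr_sum /=.
under [RHS]eq_bigr do rewrite card_set_sum.
by rewrite pair_big.
Qed.

(** The line [Ws + w *: W] is the one through [P x] and [P y]. At a common point all three values
    lie on the affine function [B z], so [P w] minus the line vanishes there; d such zeros kill
    it. *)
Lemma collinear_codewords (R : realType) (F : finFieldType) (d : R)
    (P : F -> {poly F}) (g : F -> F -> bool) (B : F -> {poly F}) (x y : F) :
  0 < d -> (forall z, (size (B z) <= 2)%N) -> x != y ->
  (forall w z, g w z -> deg_lt (P w) d /\ (P w).[z] = (B z).[w]) ->
  deg_lt (P x) d -> deg_lt (P y) d ->
  exists Ws W, [/\ deg_lt Ws d, deg_lt W d & forall w,
    d <= #|common_pts g x y w|%:R -> P w = Ws + w *: W].
Proof.
move=> d0 B2 xy hg Pxd Pyd.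
pose W := (y - x)^-1 *: P y + - (y - x)^-1 *: P x.
pose Ws := 1 *: P x + - x *: W.
have Wd : deg_lt W d by apply: deg_lt_comb.
have Wsd : deg_lt Ws d by apply: deg_lt_comb.
exists Ws, W; split=> // w dw; apply/eqP; rewrite -subr_eq0; apply/eqP.
(* One common point is enough to obtain the degree bound on [P w]. *)
have /card_gt0P[z0] : (0 < #|common_pts g x y w|)%N.
  by rewrite -(ltr_nat R) (lt_le_trans d0).
rewrite inE => /and3P[_ _ /hg[Pwd _]].
apply: (deg_lt_roots _ _ dw).
  have := deg_lt_comb 1 (-1) Pwd (deg_lt_comb 1 w Wsd Wd).
  by rewrite !scale1r scaleN1r.
move=> z; rewrite inE => /and3P[/hg[_ ex] /hg[_ ey] /hg[_ ew]].
rewrite /Ws /W !(hornerD, hornerN, hornerZ) ex ey ew.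
rewrite !(horner_coef_wide _ (B2 z)) !big_ord_recl !big_ord0 /= /bump /=.
by rewrite !expr0 !expr1; field; rewrite subr_eq0 eq_sym.
Qed.

(** * The main case and the reduction to it *)

(** The nondegenerate case; the real cube root enters only through a number [t] with the right
    cube. *)
Lemma correlated_agreement (R : realType) (F : finFieldType) (D : {set F})
    (rho delta eps eta t : R) (u us : word D) (B : F -> {poly F}) :
  let q : R := #|F|%:R in
  let d : R := rho * #|D|%:R in
  let L : R := (max_list_size D d delta)%:R in
  0 < rho <= 1 -> 0 < delta <= 1 -> (0 < #|D|)%N ->
  (forall z : F, (size (B z) <= 2)%N) -> 0 < eps < 1 / 3 ->
  0 <= t -> t ^+ 3 = d / q + eps ->
  2 * L * t <= eta -> 4 / (eps ^+ 2 * q) <= eta ->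
  eta = uprob R [pred xz : F * F | rdist_set R (affine_word us u xz.1)
                  (RSpt D rho xz.2 (B xz.2).[xz.1]) < delta] ->
  exists v vs, [/\ v \in RS D rho, vs \in RS D rho &
    (1 - delta - eps) * #|D|%:R <=
      #|[set y | (u y == v y) && (us y == vs y)]|%:R].
Proof.
move=> q d L /andP[rho0 rho1] /andP[delta0 delta1] D0 B2 /andP[eps0 eps3].
move=> t0 t3 etaL etaq etaE.
have q0 : 0 < q by rewrite ltr0n; apply/card_gt0P; exists 0.
have n0 : 0 < #|D|%:R :> R by rewrite ltr0n.
have d0 : 0 < d by rewrite mulr_gt0.
(* A probability is at most 1, so the second lower bound on [eta] makes the field large. *)
have eq4 : 4 <= eps ^+ 2 * q.
  have : eta <= 1.
    rewrite etaE /uprob ler_pdivrMr ?mul1r ?ler_nat ?max_card //.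
    by rewrite ltr0n card_prod muln_gt0 -!(ltr_nat R) q0.
  move/(le_trans etaq); rewrite ler_pdivrMr ?mul1r //.
  by rewrite mulr_gt0 // exprn_gt0.
have eta0 : 0 < eta.
  by apply: lt_le_trans etaq; rewrite divr_gt0 // mulr_gt0 // exprn_gt0.
have [P hP] : {P : word D -> {poly F} & forall f, f \in RS D rho ->
    deg_lt (P f) d /\ restr D (P f) = f}.
  apply: (@choice _ _ (fun f Q => f \in RS D rho ->
    deg_lt Q d /\ restr D Q = f)) => f.
  have [|fV] := boolP (f \in RS D rho).
    by rewrite inE => /asboolP[Q [[_ Qf] Qd]]; exists Q.
  by exists 0.
pose Lx x := List (affine_word us u x) (RS D rho) delta.
pose A x := [set z | rdist_set R (affine_word us u x)
                       (RSpt D rho z (B z).[x]) < delta].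
have [v hv] : {v : F -> word D & forall x, (#|A x| <=
    #|Lx x| * #|[set z in [set z | (P (v x)).[z] == (B z).[x]]
                  | v x \in Lx x]|)%N}.
  apply: (@choice _ _ (fun x f => (#|A x| <=
    #|Lx x| * #|[set z in [set z | (P f).[z] == (B z).[x]] | f \in Lx x]|)%N)).
  move=> x; apply: (@popular_element _ _ u (Lx x) (A x)
    (fun f => [set z | (P f).[z] == (B z).[x]])).
  apply/subsetP => z; rewrite inE => /bigmin_ltP[|[f]].
    (* The distance to an empty set defaults to 1, which is not below delta. *)
    by rewrite ltNge delta1.
  rewrite inE => /andP[fV /asboolP[Q [Qd Qf Qz]]] fclose.
  apply/bigcupP; exists f; first by rewrite /Lx /List in_set fV fclose.
  rewrite inE.
  have [Pd Pf] := hP f fV; apply/eqP.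
  by apply: (deg_lt_restr_horner rho1 Qd Pd _ Qz); rewrite Qf Pf.
pose g x z := (v x \in Lx x) && ((P (v x)).[z] == (B z).[x]).
have etaM : eta * q ^+ 2 <= L * \sum_z \sum_x (g x z)%:R.
  have -> : eta * q ^+ 2 = (\sum_x #|A x|)%:R.
    rewrite etaE; exact: (uprob_prod R (fun x z => rdist_set R
      (affine_word us u x) (RSpt D rho z (B z).[x]) < delta)).
  rewrite exchange_big natr_sum mulr_sumr.
  apply: ler_sum => x _; rewrite -card_set_sum -natrM ler_nat.
  apply: leq_trans (hv x) _; apply: leq_mul; first exact: list_size_le.
  by apply/subset_leq_card/subsetP => z; rewrite !in_set /g !in_set andbC.
(* An empty list for every word would contradict the positive probability; the factor [L] can then
   be cancelled. *)
have L0 : 0 < L.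
  rewrite lt_def ler0n andbT; apply/eqP => L0; move: etaM.
  by rewrite L0 mul0r leNgt mulr_gt0 // exprn_gt0.
have hM : 2 * t * q ^+ 2 <= \sum_z \sum_x (g x z)%:R.
  rewrite -(ler_pM2l L0); apply: le_trans etaM.
  have := ler_wpM2r (exprn_ge0 2 (ltW q0)) etaL.
  by apply: le_trans; rewrite (_ : L * _ = 2 * L * t * q ^+ 2) //; ring.
have epsq : 12 < eps * q.
  have e0 : 0 < eps * q by rewrite mulr_gt0.
  have : eps * (eps * q) < 1 / 3 * (eps * q) by rewrite ltr_pM2r.
  by move: eq4; rewrite expr2; lra.
have [x [y [xy rich]]] : exists x y, x != y /\
    8 * eps * q - 1 <= #|[set w | d <= #|common_pts g x y w|%:R]|%:R.
  by apply: rich_pair t3 _ hM => //; [exact: ltW|rewrite -mulrA; lra].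
set S := [set w | _] in rich.
have inL w z : g w z -> v w \in RS D rho /\
    rdist R (affine_word us u w) (v w) < delta.
  by case/andP; rewrite inE => /andP[].
have S_pts w : w \in S -> exists z, [&& g x z, g y z & g w z].
  rewrite inE => dw; have /card_gt0P[z] : (0 < #|common_pts g x y w|)%N.
    by rewrite -(ltr_nat R) (lt_le_trans d0).
  by rewrite inE; exists z.
(* Any common point shows that the words chosen for x and y are in their lists, hence are
   codewords. *)
have [w0 /S_pts[z0 /and3P[gx gy _]]] : exists w, w \in S.
  by apply/card_gt0P; rewrite -(ltr_nat R); apply: lt_le_trans rich; lra.
have [Pxd _] := hP _ (inL _ _ gx).1; have [Pyd _] := hP _ (inL _ _ gy).1.
have [Ws [W [Wsd Wd hW]]] : exists Ws W, [/\ deg_lt Ws d, deg_lt W d &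
    forall w, d <= #|common_pts g x y w|%:R -> P (v w) = Ws + w *: W].
  apply: (collinear_codewords (P := P \o v)) B2 xy _ Pxd Pyd => // w z gw.
  by split; [have [] := hP _ (inL _ _ gw).1|case/andP: gw => _ /eqP].
exists (restr D W), (restr D Ws); split; [exact: RS_restr|exact: RS_restr|].
have close : {in S, forall w, rdist R (affine_word us u w)
    (affine_word (restr D Ws) (restr D W) w) <= delta}.
  move=> w wS; have [z /and3P[_ _ gw]] := S_pts w wS.
  have [vV] := inL _ _ gw; rewrite -[X in rdist _ _ X](hP _ vV).2.
  rewrite inE in wS; rewrite hW // => /ltW; congr (rdist _ _ _ <= _).
  by apply/ffunP => s; rewrite !ffunE hornerD hornerZ.
have s0 : 0 < #|S|%:R :> R by apply: lt_le_trans rich; lra.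
rewrite -(ler_pM2l s0); apply: le_trans (line_agreement (ltW delta0) close).
(* Since eps |S| >= 8 eps^2 q - eps >= 32 - 1/3, the loss of |D| in [line_agreement] is absorbed by
   eps |S| |D|. *)
have : #|D|%:R <= #|S|%:R * eps * #|D|%:R :> R.
  rewrite ler_peMl // ?ltW //.
  have := ler_wpM2r (ltW eps0) rich; lra.
lra.
Qed.

Theorem mainTheorem4 (R : realType) (F : finFieldType) (D : {set F})
    (rho delta eps : R) (u ustar : word D) (B : F -> {poly F}) :
  let q : R := #|F|%:R in
  let d : R := rho * #|D|%:R in
  let V := RS D rho in
  let Lstar : R := (max_list_size D d delta)%:R in
  0 < rho ->
  0 < delta ->
  (forall z : F, (size (B z) <= 2)%N) ->
  0 < eps < 1 / 3 ->
  Num.max (2 * Lstar * (d / q + eps) `^ (1 / 3)) (4 / (eps ^+ 2 * q)) <=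
    uprob R [pred xz : F * F |
      rdist_set R (affine_word ustar u xz.1)
                  (RSpt D rho xz.2 (B xz.2).[xz.1]) < delta] ->
  (exists (v vstar : word D) (C : {set {y : F | y \in D}}),
     [/\ v \in V, vstar \in V,
         (1 - delta - eps) * #|D|%:R <= #|C|%:R,
         (forall y, y \in C -> u y = v y)
       & (forall y, y \in C -> ustar y = vstar y)]) /\
  (rdist_set R u V <= delta + eps /\ rdist_set R ustar V <= delta + eps).
Proof.
move=> q d V Lstar rho0 delta0 B2 eps03 prob.
have [eps0 eps3] := andP eps03.
suff [v [vs [C [vV vsV cardC uv usvs]]]] : exists (v vs : word D)
    (C : {set {y : F | y \in D}}), [/\ v \in V, vs \in V,
    (1 - delta - eps) * #|D|%:R <= #|C|%:R, forall y, y \in C -> u y = v y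
    & forall y, y \in C -> ustar y = vs y].
  have cardC' : (1 - (delta + eps)) * #|D|%:R <= #|C|%:R :> R.
    by rewrite opprD addrA.
  have de0 : 0 <= delta + eps by rewrite addr_ge0 ?ltW.
  split; first by exists v, vs, C.
  split; [exact: rdist_set_le uv|exact: rdist_set_le usvs].
(* For [1 <= rho] every word is a codeword, so u and ustar serve as their own witnesses on all of
   D. *)
have [rho1|rho1] := leP 1 rho.
  exists u, ustar, setT; split=> //; try exact: RS_full.
  by rewrite cardsT card_dom ler_piMl //; lra.
have zeroV : restr D 0 \in V.
  by apply: RS_restr; [exact: ltW|rewrite /deg_lt eqxx].
(* When D is empty or delta exceeds 1, the bound on |C| is nonpositive and the empty set
   suffices. *)
have trivial_C : (1 - delta - eps) * #|D|%:R <= 0 :> R ->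
    exists (v vs : word D) (C : {set {y : F | y \in D}}), [/\ v \in V,
    vs \in V, (1 - delta - eps) * #|D|%:R <= #|C|%:R,
    forall y, y \in C -> u y = v y & forall y, y \in C -> ustar y = vs y].
  move=> C0; exists (restr D 0), (restr D 0), set0.
  by split=> // [|y|y]; rewrite ?cards0 // inE.
have [D0|D0] := posnP #|D|; first by apply: trivial_C; rewrite D0 mulr0.
have [delta1|delta1] := ltP 1 delta.
  by apply: trivial_C; rewrite mulr_le0_ge0 //; lra.
move: prob; rewrite ge_max => /andP[probL probq].
have base0 : 0 <= d / q + eps.
  by rewrite addr_ge0 ?divr_ge0 ?mulr_ge0 // ltW.
have t3 : ((d / q + eps) `^ (1 / 3)) ^+ 3 = d / q + eps.
  rewrite -powR_mulrn ?powR_ge0 // -powRrM mulrVK ?powRr1 //.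
  by rewrite unitfE pnatr_eq0.
have [||v [vs [vV vsV cardC]]] := correlated_agreement _ _ D0 B2 eps03
  (powR_ge0 _ _) t3 probL probq erefl.
- by rewrite rho0 ltW.
- by rewrite delta0.
exists v, vs, [set y | (u y == v y) && (ustar y == vs y)].
by split=> // y; rewrite inE => /andP[/eqP uv /eqP usvs].
Qed.
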